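(* There are families of isospectral, equilateral, pairwise non-isomorphic quantum graphs whose size grows exponentially in the number of edges: there exist constants $C,c>0$ such that for arbitrarily large $n$ there is a family of at least $Ce^{cn}$ pairwise non-isomorphic equilateral quantum graphs with $n$ edges that are pairwise isospectral for the standard Laplacian $\Delta_0$. If the edge length is normalized to be $1$, the size of the families grows exponentially in the total edge length of the quantum graphs.
   Context: Combinatorial graphs are finite; loops and multiple edges are allowed, and a loop contributes $2$ to the degree of its vertex. All graphs are assumed connected, without isolated vertices and without vertices of degree $2$. A quantum graph $G$ is a combinatorial graph with vertex set $V$ and edge set $E$ together with a length function $L:E\to\mathbb{R}_{>0}$; each edge $e$ is identified with $[0,L(e)]$. It is equilateral if all edges have the same length. Its total edge length is $\sum_{e\in E}L(e)$. Two quantum graphs are isomorphic if there is a graph isomorphism preserving edge lengths. The standard Laplacian $\Delta_0$ acts on each edge as $f\mapsto -f''$; its domain consists of all functions $f$ that are continuous on $G$, lie in the Sobolev space $W_2$ (two derivatives in $L^2$) on each edge, and satisfy the Kirchhoff condition $\sum_{e\sim v}\nu_{v,e}(f|_e)=0$ at every vertex $v$, where $\nu_{v,e}$ is the outward unit normal of the edge $e$ at $v$ (a loop at $v$ contributes at both of its ends). Two quantum graphs are isospectral if their operators $\Delta_0$ have the same eigenvalues including multiplicities. *)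

(* Defs.v *)
From mathcomp Require Import all_boot all_order all_algebra.
From mathcomp Require Import complex.
From mathcomp Require Import all_classical all_reals all_analysis.
Import Order.TTheory GRing.Theory Num.Theory.
Set Implicit Arguments.
Unset Strict Implicit.
Unset Printing Implicit Defensive.
Local Open Scope classical_set_scope.
Local Open Scope ring_scope.

(* A pair (e, b) is an end of the edge e; a loop has both its ends at the same
   vertex. Which end is called [false] is an arbitrary choice, made only in
   order to identify e with an interval; see [qg_iso]. *)
Record multigraph := Multigraph {
  vertex : finType;
  edge : finType;
  endpoint : edge -> bool -> vertex
}.

Definition degree (G : multigraph) (v : vertex G) : nat :=
  #|[set h : edge G * bool | endpoint h.1 h.2 == v]|.

Definition adjacent (G : multigraph) : rel (vertex G) :=
  fun u v => [exists h : edge G * bool,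
    (endpoint h.1 h.2 == u) && (endpoint h.1 (~~ h.2) == v)].

Definition connected_graph (G : multigraph) : Prop :=
  (0 < #|vertex G|)%N /\ forall u v : vertex G, connect (@adjacent G) u v.

Record quantum_graph (R : realType) := QuantumGraph {
  qg_graph :> multigraph;
  qg_connected : connected_graph qg_graph;
  qg_no_isolated : forall v : vertex qg_graph, degree v <> 0%N;
  qg_no_degree2 : forall v : vertex qg_graph, degree v <> 2%N;
  edge_length : edge qg_graph -> R;
  edge_length_gt0 : forall e, 0 < edge_length e
}.

Section QuantumGraph.
Variable R : realType.

Definition equilateral (G : quantum_graph R) : Prop :=
  forall e e' : edge G, edge_length e = edge_length e'.

Definition total_length (G : quantum_graph R) : R :=
  \sum_(e : edge G) edge_length e.

(* The bit s says whether the edge is mapped with its two ends exchanged. *)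
Definition qg_iso (G H : quantum_graph R) : Prop :=
  exists (phi : vertex G -> vertex H) (psi : edge G -> edge H),
    [/\ bijective phi, bijective psi,
        forall e, exists s : bool,
          forall b, endpoint (psi e) b = phi (endpoint e (s (+) b)) &
        forall e, edge_length (psi e) = edge_length e].

(* On the compact interval [0, L]: f is absolutely continuous and g, which is
   square integrable, is its weak derivative; thus f lies in W_2^1(0, L) and is
   the continuous representative of its class. *)
Definition real_weak_derivative (L : R) (f g : R -> R) : Prop :=
  [/\ measurable_fun `[0, L] g,
      lebesgue_measure.-integrable `[0, L] (fun t => (g t ^+ 2)%:E) &
      forall x, x \in `[0, L] ->
        f x = f 0 + \int[lebesgue_measure]_(t in `[0, x]) g t].

Definition weak_derivative (L : R) (f g : R -> R[i]) : Prop :=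
  real_weak_derivative L (fun t => complex.Re (f t)) (fun t => complex.Re (g t))
  /\
  real_weak_derivative L (fun t => complex.Im (f t)) (fun t => complex.Im (g t)).

(* f has two derivatives in L^2(0, L): the first one, f1, is again absolutely
   continuous, hence has well-defined values at 0 and L; the second one, f2, is
   determined almost everywhere. *)
Definition sobolev_W2 (L : R) (f f1 f2 : R -> R[i]) : Prop :=
  weak_derivative L f f1 /\ weak_derivative L f1 f2.

(* A function on G is a family (f e) of complex functions, f e being considered
   on [0, edge_length e] only. *)
Definition qg_fun (G : quantum_graph R) := edge G -> R -> R[i]^o.

Definition end_coord (G : quantum_graph R) (e : edge G) (b : bool) : R :=
  if b then edge_length e else 0.

(* Continuity in the interior of the edges is part of [sobolev_W2]. *)
Definition continuous_at_vertices (G : quantum_graph R) (f : qg_fun G) : Prop :=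
  exists F : vertex G -> R[i],
    forall e b, f e (end_coord e b) = F (endpoint e b).

Definition outward_derivative (G : quantum_graph R) (f1 : qg_fun G)
    (e : edge G) (b : bool) : R[i] :=
  if b then f1 e (edge_length e) else - f1 e 0.

Definition kirchhoff (G : quantum_graph R) (f1 : qg_fun G) : Prop :=
  forall v : vertex G,
    \sum_(h : edge G * bool | endpoint h.1 h.2 == v)
      outward_derivative f1 h.1 h.2 = 0.

(* f is in the domain of the standard Laplacian, which maps it to g. *)
Definition standard_laplacian (G : quantum_graph R) (f g : qg_fun G) : Prop :=
  exists f1 f2 : qg_fun G,
    [/\ forall e, sobolev_W2 (edge_length e) (f e) (f1 e) (f2 e),
        continuous_at_vertices f,
        kirchhoff f1 &
        forall e, {ae lebesgue_measure, forall t : R,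
          t \in `[0, edge_length e] -> g e t = - f2 e t}].

(* The value 0 outside of the edges makes the representation of a continuous
   function on G as an element of [qg_fun G] unique, so that this set is a copy
   of the actual eigenspace. *)
Definition laplacian_eigenspace (G : quantum_graph R) (lambda : R[i]) : set (qg_fun G) :=
  [set f | standard_laplacian f (fun e t => lambda * f e t) /\
           forall e t, t \notin `[0, edge_length e] -> f e t = 0].

Definition has_dimension (K : fieldType) (V : lmodType K) (S : set V) (k : nat)
    : Prop :=
  exists b : 'I_k -> V,
    (forall a : 'I_k -> K, \sum_i a i *: b i = 0 -> forall i, a i = 0) /\
    S = [set v | exists a : 'I_k -> K, v = \sum_i a i *: b i].

(* k = 0 means that lambda is not an eigenvalue. *)
Definition multiplicity (G : quantum_graph R) (lambda : R[i]) (k : nat) : Prop :=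
  @has_dimension R[i] (edge G -> R -> R[i]^o) (laplacian_eigenspace lambda) k.

Definition isospectral (G H : quantum_graph R) : Prop :=
  forall (lambda : R[i]) (k : nat),
    multiplicity G lambda k <-> multiplicity H lambda k.

Definition isospectral_family (m : nat) (G : 'I_m -> quantum_graph R) : Prop :=
  [/\ forall i, equilateral (G i),
      forall i j, i != j -> ~ qg_iso (G i) (G j) &
      forall i j, isospectral (G i) (G j)].

End QuantumGraph.

(* Main.v *)
From HB Require Import structures.
Require Import Defs.
From mathcomp Require Import all_boot all_order all_algebra.
From mathcomp Require Import complex.
From mathcomp Require Import all_classical all_reals all_analysis.
From mathcomp Require Import measurable_realfun ring lra.
Import Order.TTheory GRing.Theory Num.Theory.
Set Implicit Arguments.
Unset Strict Implicit.
Unset Printing Implicit Defensive.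
Local Open Scope classical_set_scope.
Local Open Scope ring_scope.

(** The graphs come from words w of length k in two letters. A string of k
vertices, the hubs, is joined by edges, with a loop at the first hub; to the
i-th hub six sites are attached by spokes, and the letter w i decides by which
of two actions of the Klein four-group V = {1, a, b, ab} an a-edge and a b-edge
leave every site. All edges have length 1, and there are 19 k of them.

For one letter the six sites are V with its translations together with two
fixed points; for the other they are V/<a>, V/<b> and V/<ab>. As V-sets these
differ, but their permutation representations are equivalent: both contain the
trivial representation three times and every other character once. There is
even an intertwiner whose rows and columns all sum to 1
([intertwiner_equivariant], [intertwiner_row], [intertwiner_col],
[intertwinerK]).

Hence one letter can be exchanged for the other by transplantation. A function
f on the graph is replaced, on the spokes, the a-edges and the b-edges of the
i-th block, by the combinations of f on the edges of the same kind with the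
coefficients of the intertwiner, and is kept on the edges between hubs.
Equivariance makes the combinations fit together at the sites. Row sums equal
to 1 make the values at the hub agree with the old value, and column sums equal
to 1 leave the total derivative at the hub unchanged, so that the rest of the
graph does not notice the exchange. As all edges have the same length,
combinations of solutions of - f'' = lambda f on different edges are again
solutions; thus transplantation maps each eigenspace into the corresponding
one, with the transplantation by the inverse intertwiner as its inverse
([transplant_isospectral]), and no differential equation has to be solved.

The word can be read off the graph ([word_graph_iso_inj]). Hubs are the
vertices with more than three neighbours; the first one carries a loop and from
it the string of hubs can be followed; and a block has the first letter exactly
when its hub has a neighbour, a common fixed point of a and b, that is adjacent
to nothing else but itself. So there are 2 ^ k pairwise non-isomorphic
isospectral graphs with n = 19 k edges and total length n, and
2 ^ k = exp ((ln 2 / 19) n). *)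

(** * Linear combinations of Sobolev functions *)

(** Needed to split the integral of a sum in [real_weak_derivative_linear]; it
    comes from 2 |g| <= 1 + g ^ 2 on an interval of finite length. *)
Lemma square_integrable_integrable (R : realType) (a b : R) (g : R -> R) :
  measurable_fun `[a, b] g ->
  lebesgue_measure.-integrable `[a, b] (fun t => (g t ^+ 2)%:E) ->
  lebesgue_measure.-integrable `[a, b] (EFin \o g).
Proof.
move=> mg ig2.
have i1 : lebesgue_measure.-integrable `[a, b] (EFin \o cst (1 : R)).
  apply/integrableP; split; first exact/measurable_EFinP.
  under eq_integral do rewrite /= normr1.
  rewrite integral_cst //= mul1e lebesgue_measure_itv /=.
  by case: ifP => _; rewrite ?ltry // -EFinD ltry.
apply: le_integrable (integrableD _ i1 ig2) => //.
  exact/measurable_EFinP.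
move=> t _ /=; rewrite lee_fin [leRHS]ger0_norm ?addr_ge0 ?sqr_ge0 //.
rewrite -[g t ^+ 2]real_normK ?num_real //.
by have := sqr_ge0 (`|g t| - 1); nra.
Qed.

Lemma real_weak_derivative0 (R : realType) (L : R) :
  real_weak_derivative L (fun=> 0) (fun=> 0).
Proof.
split.
- exact: measurable_cst.
- rewrite (_ : (fun=> _) = cst 0%E); first exact: integrable0.
  by apply/funext => t; rewrite expr0n.
- by move=> x _; rewrite Rintegral_cst ?mul0r ?addr0.
Qed.

Lemma real_weak_derivative_linear (R : realType) (L c : R)
    (f g f' g' : R -> R) :
  real_weak_derivative L f f' -> real_weak_derivative L g g' ->
  real_weak_derivative L (fun t => c * f t + g t) (fun t => c * f' t + g' t).
Proof.
move=> [mf if2 hf] [mg ig2 hg].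
have mcf : measurable_fun `[0, L] (fun t => c * f' t) by exact: measurable_funM.
have ms : measurable_fun `[0, L] (fun t => c * f' t + g' t).
  exact: measurable_funD.
split=> //.
- have := integrableD _ (integrableZl _ (2 * c ^+ 2) if2)
    (integrableZl _ 2 ig2).
  move=> /(_ (measurable_itv _) (measurable_itv _) (measurable_itv _)).
  apply: le_integrable => //.
    by apply/measurable_EFinP; exact: measurable_funX.
  move=> t _ /=; rewrite lee_fin (ger0_norm (sqr_ge0 _)) ler_normr.
  by apply/orP; left; have := sqr_ge0 (c * f' t - g' t); nra.
- move=> x xL; rewrite hf // hg //.
  have sub : `[0, x] `<=` `[0, L].
    move=> t /=; rewrite !in_itv /= => /andP[-> tx] /=.
    by apply: (le_trans tx); move: xL; rewrite in_itv /= => /andP[].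
  have int0x (h : R -> R) : measurable_fun `[0, L] h ->
      lebesgue_measure.-integrable `[0, L] (fun t => (h t ^+ 2)%:E) ->
      lebesgue_measure.-integrable `[0, x] (EFin \o h).
    move=> mh ih; apply: (@integrableS _ _ _ lebesgue_measure `[0, L] `[0, x]) => //.
    exact: square_integrable_integrable.
  rewrite RintegralD //; last exact: int0x.
    rewrite RintegralZl //; last exact: int0x.
    by rewrite mulrDr addrACA.
  rewrite (_ : _ \o _ = (fun t => c%:E * (EFin \o f') t))%E.
    by apply: integrableZl => //; exact: int0x.
  by apply/funext => t.
Qed.

Lemma real_weak_derivative_sum (R : realType) (L : R) (I : Type) (r : seq I)
    (c : I -> R) (f f' : I -> R -> R) :
  (forall i, real_weak_derivative L (f i) (f' i)) ->
  real_weak_derivative L (fun t => \sum_(i <- r) c i * f i t)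
    (fun t => \sum_(i <- r) c i * f' i t).
Proof.
move=> h; elim: r => [|i r IH].
  under eq_fun do rewrite big_nil.
  under [X in real_weak_derivative _ _ X]eq_fun do rewrite big_nil.
  exact: real_weak_derivative0.
under eq_fun do rewrite big_cons.
under [X in real_weak_derivative _ _ X]eq_fun do rewrite big_cons.
exact: real_weak_derivative_linear.
Qed.

Local Open Scope complex_scope.

Lemma Re_real_lincomb (R : realType) (I : Type) (r : seq I) (c : I -> R)
    (z : I -> R[i]) :
  complex.Re (\sum_(i <- r) (c i)%:C * z i)
  = \sum_(i <- r) c i * complex.Re (z i).
Proof.
elim/big_rec2: _ => // i x y _ <-.
by case: (z i) y => [a b] [u v] /=; rewrite mul0r subr0.
Qed.

Lemma Im_real_lincomb (R : realType) (I : Type) (r : seq I) (c : I -> R)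
    (z : I -> R[i]) :
  complex.Im (\sum_(i <- r) (c i)%:C * z i)
  = \sum_(i <- r) c i * complex.Im (z i).
Proof.
elim/big_rec2: _ => // i x y _ <-.
by case: (z i) y => [a b] [u v] /=; rewrite mul0r addr0.
Qed.

Lemma sobolev_W2_sum (R : realType) (L : R) (I : Type) (r : seq I)
    (c : I -> R) (f f1 f2 : I -> R -> R[i]) :
  (forall i, sobolev_W2 L (f i) (f1 i) (f2 i)) ->
  sobolev_W2 L (fun t => \sum_(i <- r) (c i)%:C * f i t)
    (fun t => \sum_(i <- r) (c i)%:C * f1 i t)
    (fun t => \sum_(i <- r) (c i)%:C * f2 i t).
Proof.
have wd (g g' : I -> R -> R[i]) : (forall i, weak_derivative L (g i) (g' i)) ->
    weak_derivative L (fun t => \sum_(i <- r) (c i)%:C * g i t)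
      (fun t => \sum_(i <- r) (c i)%:C * g' i t).
  move=> h; split.
    under eq_fun do rewrite Re_real_lincomb.
    under [X in real_weak_derivative _ _ X]eq_fun do rewrite Re_real_lincomb.
    by apply: real_weak_derivative_sum => i; have [] := h i.
  under eq_fun do rewrite Im_real_lincomb.
  under [X in real_weak_derivative _ _ X]eq_fun do rewrite Im_real_lincomb.
  by apply: real_weak_derivative_sum => i; have [] := h i.
by move=> h; split; apply: wd => i; have [] := h i.
Qed.

(** * Transplantation *)

Section Transplantation.
Variable R : realType.

(** K transfers functions on edges and A functions on vertices. If the end
    values of a function on the edges of G come from a function F on the
    vertices, then the transferred end values come from the transfer of F.
    The sides b = false and b = true are kept apart: no edge is reversed. *)
Definition respects_incidence (G H : multigraph) (K : edge H -> edge G -> R)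
    (A : vertex H -> vertex G -> R) : Prop :=
  forall (F : vertex G -> R) (e : edge H) (b : bool),
    \sum_e' K e e' * F (endpoint e' b) = \sum_v A (endpoint e b) v * F v.

(** K and A being real, real and imaginary parts may be treated separately. *)
Lemma respects_incidenceC (G H : multigraph) (K : edge H -> edge G -> R)
    (A : vertex H -> vertex G -> R) (F : vertex G -> R[i]) e b :
  respects_incidence K A ->
  \sum_e' (K e e')%:C * F (endpoint e' b)
  = \sum_v (A (endpoint e b) v)%:C * F v.
Proof.
move=> KA; apply/eqP; rewrite eq_complex !Re_real_lincomb !Im_real_lincomb.
rewrite (KA (fun v => complex.Re (F v))) (KA (fun v => complex.Im (F v))).
by rewrite !eqxx.
Qed.

Definition transplant (I J : finType) (K : J -> I -> R) (f : I -> R -> R[i]^o) :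
    J -> R -> R[i]^o :=
  fun j t => \sum_i (K j i)%:C * f i t.

Lemma transplant_is_linear (I J : finType) (K : J -> I -> R) :
  linear (transplant K).
Proof.
move=> a f g; apply/funext => j; apply/funext => t.
rewrite /transplant !fctE scaler_sumr -big_split /=.
by apply: eq_bigr => i _; rewrite mulrDr /GRing.scale /= mulrCA.
Qed.

HB.instance Definition _ (I J : finType) (K : J -> I -> R) :=
  GRing.isLinear.Build R[i] (I -> R -> R[i]^o) (J -> R -> R[i]^o) *:%R
    (transplant K) (transplant_is_linear K).

Lemma transplantK (I J : finType) (K : J -> I -> R) (K' : I -> J -> R) :
  (forall i i', \sum_j K' i j * K j i' = (i == i')%:R) ->
  cancel (transplant K) (transplant K').
Proof.
move=> K'K f; apply/funext => i; apply/funext => t; rewrite /transplant.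
under eq_bigr do rewrite mulr_sumr.
rewrite exchange_big /= (bigD1 i) //= [X in _ + X]big1 => [|i' /negPf ni'].
  under eq_bigr do rewrite mulrA -rmorphM.
  by rewrite -mulr_suml -rmorph_sum K'K eqxx mul1r addr0.
under eq_bigr do rewrite mulrA -rmorphM.
by rewrite -mulr_suml -rmorph_sum K'K eq_sym ni' mul0r.
Qed.

(** Kirchhoff's condition is dual to continuity, whence the transposes:
    applying them to the indicator function of a vertex v of H expresses the
    sum of the outward derivatives of the transplanted function at v as the
    combination, with coefficients A v u, of the sums of those of f at the
    vertices u. *)
Lemma transplant_kirchhoff (G H : quantum_graph R) (K : edge H -> edge G -> R)
    (A : vertex H -> vertex G -> R) (f1 : qg_fun G) :
  (forall (e : edge G) (e' : edge H), edge_length e = edge_length e') ->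
  respects_incidence (fun e e' => K e' e) (fun v v' => A v' v) ->
  kirchhoff f1 -> kirchhoff (transplant K f1 : qg_fun H).
Proof.
move=> sameL KA kf v.
pose d (h : edge G * bool) := outward_derivative f1 h.1 h.2.
have dT (h : edge H * bool) :
    outward_derivative (transplant K f1 : qg_fun H) h.1 h.2
    = \sum_e (K h.1 e)%:C * d (e, h.2).
  rewrite /d /outward_derivative /transplant; case: h => e' [] /=.
    by apply: eq_bigr => e _; rewrite (sameL e e').
  by rewrite -sumrN; apply: eq_bigr => e _; rewrite mulrN.
have kfA : \sum_(h : edge G * bool) (A v (endpoint h.1 h.2))%:C * d h = 0.
  rewrite (partition_big (fun h => endpoint h.1 h.2) predT) //=.
  rewrite big1 // => u _.
  under eq_bigr => h /eqP -> do [].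
  by rewrite -mulr_sumr kf mulr0.
rewrite -[RHS]kfA; under eq_bigr do rewrite dT.
rewrite big_mkcond /=.
rewrite -(pair_bigA _ (fun e' b => if endpoint e' b == v then
   \sum_e (K e' e)%:C * d (e, b) else 0)) /=.
rewrite -(pair_bigA _ (fun e b => (A v (endpoint e b))%:C * d (e, b))) /=.
rewrite exchange_big [RHS]exchange_big /=; apply: eq_bigr => b _.
transitivity (\sum_(e' : edge H) \sum_e
    ((K e' e)%:C * (endpoint e' b == v)%:R) * d (e, b)).
  apply: eq_bigr => e' _; case: eqP => _; apply/esym.
    by apply: eq_bigr => e _; rewrite mulr1.
  by apply: big1 => e _; rewrite mulr0 mul0r.
rewrite exchange_big /=; apply: eq_bigr => e _.
rewrite -mulr_suml; congr (_ * _).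
rewrite (respects_incidenceC (fun u => (u == v)%:R) e b KA).
rewrite (bigD1 v) //= eqxx mulr1 big1 ?addr0 // => u /negPf ->.
by rewrite mulr0.
Qed.

Lemma transplant_eigenspace (G H : quantum_graph R) (K : edge H -> edge G -> R)
    (A : vertex H -> vertex G -> R) (lambda : R[i]) (f : qg_fun G) :
  (forall (e : edge G) (e' : edge H), edge_length e = edge_length e') ->
  respects_incidence K A ->
  respects_incidence (fun e e' => K e' e) (fun v v' => A v' v) ->
  laplacian_eigenspace lambda f ->
  laplacian_eigenspace lambda (transplant K f : qg_fun H).
Proof.
move=> sameL KA KAT [[f1 [f2 [sf [F Ff] kf lf]]] f0]; split; last first.
  move=> e' t te'; rewrite /transplant big1 // => e _.
  by rewrite f0 ?mulr0 // (sameL e e').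
exists (transplant K f1), (transplant K f2); split.
- move=> e'; apply: (@sobolev_W2_sum _ _ _ _ (K e')) => e.
  by rewrite -(sameL e e').
- exists (fun v => \sum_u (A v u)%:C * F u) => e' b.
  rewrite -(respects_incidenceC F e' b KA); apply: eq_bigr => e _.
  by rewrite -Ff /end_coord; case: b; rewrite ?(sameL e e').
- exact: (transplant_kirchhoff sameL KAT).
- have aeF := ae_filter_ringOfSetsType (@lebesgue_measure R).
  move=> e'; apply: (@filterS _ _ aeF) (@filter_forall _ _ _ _ aeF lf).
  move=> t lft te'; rewrite /transplant mulr_sumr -sumrN.
  apply: eq_bigr => e _; rewrite mulrCA -mulrN lft //.
  by rewrite (sameL e e').
Qed.

Lemma has_dimension_cancel (F : fieldType) (V W : lmodType F) (S : set V)
    (S' : set W) (T : {linear V -> W}) (T' : {linear W -> V}) (k : nat) :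
  cancel T T' -> cancel T' T ->
  (forall v, S v -> S' (T v)) -> (forall w, S' w -> S (T' w)) ->
  has_dimension S k -> has_dimension S' k.
Proof.
move=> TK T'K TS T'S [b [free_b defS]]; exists (T \o b); split.
  move=> a; under eq_bigr do rewrite /= -linearZ.
  rewrite -linear_sum => /(congr1 T'); rewrite TK linear0; exact: free_b.
rewrite eqEsubset; split=> [w /T'S|w [a ->]].
  rewrite defS => -[a defw]; exists a; rewrite -[w]T'K defw linear_sum.
  by apply: eq_bigr => i _; rewrite linearZ.
under eq_bigr do rewrite /= -linearZ.
by rewrite -linear_sum; apply: TS; rewrite defS; exists a.
Qed.

Lemma transplant_isospectral (G H : quantum_graph R)
    (K : edge H -> edge G -> R) (K' : edge G -> edge H -> R)
    (A : vertex H -> vertex G -> R) (A' : vertex G -> vertex H -> R) :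
  (forall (e : edge G) (e' : edge H), edge_length e = edge_length e') ->
  respects_incidence K A ->
  respects_incidence (fun e e' => K e' e) (fun v v' => A v' v) ->
  respects_incidence K' A' ->
  respects_incidence (fun e e' => K' e' e) (fun v v' => A' v' v) ->
  (forall e e', \sum_j K' e j * K j e' = (e == e')%:R) ->
  (forall e e', \sum_j K e j * K' j e' = (e == e')%:R) ->
  isospectral G H.
Proof.
move=> sameL KA KAT KA' KAT' K'K KK' lambda k.
have T f := transplant_eigenspace (lambda := lambda) (f := f) sameL KA KAT.
have T' f := transplant_eigenspace (lambda := lambda) (f := f)
  (fun e e' => esym (sameL e' e)) KA' KAT'.
pose TK := transplantK K'K; pose T'K := transplantK KK'.
split; first exact: (has_dimension_cancel TK T'K T T').
exact: (has_dimension_cancel T'K TK T' T).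
Qed.

End Transplantation.

(** * Two linearly equivalent permutation representations *)

(** The six sites, as a set acted upon by a (the bit true) and b (the bit
    false). Letter false: (Some s, t) is the element of V = {1, a, b, ab}
    with coordinates s along a and t along b, and the two (None, t) are
    fixed points. Letter true: the first component is one of the orbits
    V/<b> (Some true), V/<a> (Some false) and V/<ab> (None), the second one
    of its two cosets. *)
Definition site := (option bool * bool)%type.

Definition act (w g : bool) (x : site) : site :=
  match w, x with
  | false, (Some s, t) => if g then (Some (~~ s), t) else (Some s, ~~ t)
  | false, (None, t) => (None, t)
  | true, (o, t) => (o, t (+) (if o is Some h then g == h else true))
  end.

Lemma actK w g : involutive (act w g).
Proof. by case: w g => [] [] [[[]|] []]. Qed.

(** Four times the intertwiner from letter w to letter w', as an integer
    matrix so that its properties are checked by computation.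

    From false to true, a function f on V and on the fixed points p, q goes
    to the sums of f over the cosets in V/<b>, V/<a> and V/<ab>, with
    weights 1/2, 1/4 and 1/4, plus 0, f p / 2 and f q / 2 respectively. Each
    nontrivial character of V occurs in exactly one of the three orbits, and
    on the invariant functions the map is (s, p, q) |-> (s, (s + p) / 2, (s
    + q) / 2), so it is invertible.

    From true to false is the inverse: if t1, t2, t3 denote the functions on
    the three orbits, then f (v) = t1 (v) + (t2 (v) - t2 (v')) + (t3 (v) -
    t3 (v')), where v' stands for the other coset, and f p, f q are the sums
    of t2 and of t3 over their orbits, both diminished by the mean of t1. *)
Definition intertwiner4 (w' w : bool) (y x : site) : int :=
  match w', w with
  | true, false =>
      match y, x with
      | (Some true, t), (Some s, _) => if s == t then 2 else 0
      | (Some false, t), (Some _, u) => if u == t then 1 else 0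
      | (None, t), (Some s, u) => if s (+) u == t then 1 else 0
      | (Some true, _), (None, _) => 0
      | (Some false, _), (None, u) => if u then 0 else 2
      | (None, _), (None, u) => if u then 2 else 0
      end
  | false, true =>
      match y, x with
      | (Some s, _), (Some true, t) => if s == t then 4 else 0
      | (Some _, u), (Some false, t) => if u == t then 4 else -4
      | (Some s, u), (None, t) => if s (+) u == t then 4 else -4
      | (None, _), (Some true, _) => -2
      | (None, u), (Some false, _) => if u then 0 else 4
      | (None, u), (None, _) => if u then 4 else 0
      end
  | _, _ => if y == x then 4 else 0
  end.

Lemma big_option (V : nmodType) (T : finType) (F : option T -> V) :
  \sum_o F o = F None + \sum_x F (Some x).
Proof.
rewrite (bigD1 None) //=; congr (_ + _).
rewrite (reindex_omap Some id) //= => [|[]//].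
by apply: eq_bigl => x; rewrite eqxx.
Qed.

Lemma big_site (V : nmodType) (F : site -> V) :
  \sum_x F x = (F (None, true) + F (None, false))
    + ((F (Some true, true) + F (Some true, false))
       + (F (Some false, true) + F (Some false, false))).
Proof.
rewrite (eq_bigr (fun x => F (x.1, x.2))) => [|[]//].
by rewrite -(pair_bigA _ (fun o t => F (o, t))) /= big_option !big_bool.
Qed.

Lemma intertwiner4_equivariant w' w g y x :
  intertwiner4 w' w (act w' g y) (act w g x) = intertwiner4 w' w y x.
Proof.
by case: w' w g y x => [] [] [] [[[]|] []] [[[]|] []].
Qed.

Lemma intertwiner4_row w' w y : \sum_x intertwiner4 w' w y x = 4.
Proof. by rewrite big_site; case: w' w y => [] [] [[[]|] []]. Qed.

Lemma intertwiner4_col w' w x : \sum_y intertwiner4 w' w y x = 4.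
Proof. by rewrite big_site; case: w' w x => [] [] [[[]|] []]. Qed.

Lemma intertwiner4K w' w x x' :
  \sum_y intertwiner4 w w' x y * intertwiner4 w' w y x' = (x == x')%:R * 16.
Proof.
by rewrite big_site; case: w' w x x' => [] [] [[[]|] []] [[[]|] []].
Qed.

Section Intertwiner.
Variable R : realType.

Definition intertwiner (w' w : bool) (y x : site) : R :=
  (intertwiner4 w' w y x)%:~R / 4.

Lemma intertwiner_equivariant w' w g y x :
  intertwiner w' w (act w' g y) (act w g x) = intertwiner w' w y x.
Proof. by rewrite /intertwiner intertwiner4_equivariant. Qed.

Lemma intertwiner_row w' w y : \sum_x intertwiner w' w y x = 1.
Proof.
by rewrite -mulr_suml -rmorph_sum intertwiner4_row divff ?intr_eq0.
Qed.

Lemma intertwiner_col w' w x : \sum_y intertwiner w' w y x = 1.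
Proof.
by rewrite -mulr_suml -rmorph_sum intertwiner4_col divff ?intr_eq0.
Qed.

Lemma intertwinerK w' w x x' :
  \sum_y intertwiner w w' x y * intertwiner w' w y x' = (x == x')%:R.
Proof.
under eq_bigr do rewrite /intertwiner mulrACA -rmorphM.
rewrite -mulr_suml -rmorph_sum intertwiner4K rmorphM rmorph_nat -mulrA.
by rewrite [X in _ * X](_ : _ = 1) ?mulr1 //; field.
Qed.

End Intertwiner.

(** * The graph of a word *)

(* Adjacency of vertices, as opposed to that of numerical sequences. *)
Local Notation adjacent := Defs.adjacent.

Section WordGraph.
Variable k : nat.

Lemma ord_pred_subproof (i : 'I_k) : (i.-1 < k)%N.
Proof. exact: leq_ltn_trans (leq_pred i) (ltn_ord i). Qed.

Definition previous (i : 'I_k) : 'I_k := Ordinal (ord_pred_subproof i).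

Definition word_vertex := ('I_k * option site)%type.
Definition word_edge := ('I_k * option (site * option bool))%type.

(** The edge (i, None) goes from hub i to the hub before it; for i = 0 it is
    a loop, which marks the beginning of the word. The edge (i, Some (x,
    None)) is the spoke of the site x, and (i, Some (x, Some g)) leads from
    x to its image under g. An orbit {x, g x} thus gives two parallel edges,
    a fixed point a loop. *)
Definition word_endpoint (w : 'I_k -> bool) (e : word_edge) (b : bool) :
    word_vertex :=
  match e.2 with
  | None => (if b then previous e.1 else e.1, None)
  | Some (x, o) =>
      (e.1, if b then omap (fun g => act (w e.1) g x) o else Some x)
  end.

Definition word_graph (w : 'I_k -> bool) : multigraph :=
  Multigraph (word_endpoint w).

Lemma word_adjP (w : 'I_k -> bool) (u v : word_vertex) :
  reflect (exists e b, word_endpoint w e b = u /\ word_endpoint w e (~~ b) = v)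
    (adjacent (G := word_graph w) u v).
Proof.
apply: (iffP existsP) => [[[e b] /andP[/eqP eu /eqP ev]]|[e [b [eu ev]]]].
  by exists e, b.
by exists (e, b); rewrite /= eu ev !eqxx.
Qed.

Lemma adj_hubs (w : 'I_k -> bool) (i j : 'I_k) :
  adjacent (G := word_graph w) (i, None) (j, None)
  = (previous i == j) || (previous j == i).
Proof.
apply/word_adjP/orP => [[[l [[x [g|]]|]] [[] [//= [<-] [<-]]]]|].
- by right.
- by left.
- case=> /eqP <-; first by exists (i, None), false.
  by exists (j, None), true.
Qed.

Lemma adj_hub_site (w : 'I_k -> bool) (i j : 'I_k) (x : site) :
  adjacent (G := word_graph w) (i, None) (j, Some x) = (i == j).
Proof.
apply/word_adjP/eqP => [[[l [[y [g|]]|]] [[] [//= [<-] [<-]]]]|<-] //.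
by exists (i, Some (x, None)), true.
Qed.

Lemma adj_sites (w : 'I_k -> bool) (i j : 'I_k) (x y : site) :
  adjacent (G := word_graph w) (i, Some x) (j, Some y)
  = (i == j) && [exists g, act (w i) g x == y].
Proof.
apply/word_adjP/andP => [[[l [[z [g|]]|]] [[] [//= [<- <-] [<- <-]]]]|].
- by split=> //; apply/existsP; exists g; rewrite actK.
- by split=> //; apply/existsP; exists g.
- move=> [/eqP <- /existsP[g /eqP <-]].
  by exists (i, Some (x, Some g)), false.
Qed.

Lemma adjacent_sym (G : multigraph) : symmetric (@adjacent G).
Proof.
move=> u v; apply/existsP/existsP => -[[e b] /andP[eu ev]];
  by exists (e, ~~ b); rewrite /= negbK eu ev.
Qed.

Lemma word_graph_connected (w : 'I_k -> bool) :
  (0 < k)%N -> connected_graph (word_graph w).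
Proof.
move=> k_gt0; pose o : 'I_k := Ordinal k_gt0.
split; first by apply/card_gt0P; exists (o, None).
have csym : connect_sym (@adjacent (word_graph w)).
  exact: sym_connect_sym (@adjacent_sym _).
suff co u : connect (@adjacent (word_graph w)) (o, None) u.
  by move=> u v; apply: connect_trans (co v); rewrite csym.
have hub n (lt_nk : (n < k)%N) :
    connect (@adjacent (word_graph w)) (o, None) (Ordinal lt_nk, None).
  elim: n => [|n IHn] in lt_nk *.
    by rewrite (_ : Ordinal _ = o) ?connect0 //; exact: val_inj.
  apply: connect_trans (IHn (ltnW lt_nk)) (connect1 _).
  by rewrite adj_hubs; apply/orP; right; apply/eqP/val_inj.
case: u => [[n lt_nk] [x|]] //.
by apply: connect_trans (hub n lt_nk) (connect1 _); rewrite adj_hub_site.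
Qed.

(** Three half-edges are exhibited at each vertex: at a site the starts of its
    spoke, a-edge and b-edge, at a hub the ends of three spokes. *)
Lemma word_graph_degree (w : 'I_k -> bool) (v : vertex (word_graph w)) :
  (2 < degree v)%N.
Proof.
suff [f f_inj fv] : exists2 f : 'I_3 -> word_edge * bool,
    injective f & forall a, word_endpoint w (f a).1 (f a).2 = v.
  rewrite -[3%N]card_ord -(card_codom f_inj); apply: subset_leq_card.
  apply/fintype.subsetP => _ /codomP[a ->].
  by rewrite inE; apply/eqP; exact: fv.
case: v => i [x|].
  exists (fun a => ((i, Some (x, nth None [:: None; Some true; Some false] a)),
    false)) => // a b [] /eqP.
  by rewrite nth_uniq // => /eqP/val_inj.
exists (fun a => ((i, Some (nth (None, true) [:: (None, true); (None, false);
  (Some true, true)] a, None)), true)) => // a b [] /eqP.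
by rewrite nth_uniq // => /eqP/val_inj.
Qed.

Variable R : realType.

Definition word_quantum_graph (k_gt0 : (0 < k)%N) (w : 'I_k -> bool) :
    quantum_graph R.
Proof.
apply: (@QuantumGraph R (word_graph w) _ _ _ (fun=> 1)) => //.
- exact: word_graph_connected.
- by move=> v v0; have := word_graph_degree v; rewrite v0.
- by move=> v v2; have := word_graph_degree v; rewrite v2.
Defined.

Lemma card_word_edge : #|{: word_edge}| = (k * 19)%N.
Proof.
by rewrite card_prod card_option !card_prod !card_option !card_bool card_ord.
Qed.

(** * Isospectrality *)

Section Transplant.
Variables (w w' : 'I_k -> bool) (M : 'I_k -> site -> site -> R).

(** Edges of the same kind (spokes, a-edges or b-edges) are combined by M i,
    the edge between hubs is kept. *)
Definition edge_block (i : 'I_k) (c c' : option (site * option bool)) : R :=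
  match c, c' with
  | Some (y, o), Some (x, o') => (o == o')%:R * M i y x
  | None, None => 1
  | _, _ => 0
  end.

Definition edge_matrix (e e' : word_edge) : R :=
  (e.1 == e'.1)%:R * edge_block e.1 e.2 e'.2.

Definition vertex_block (i : 'I_k) (c c' : option site) : R :=
  match c, c' with
  | Some y, Some x => M i y x
  | None, None => 1
  | _, _ => 0
  end.

Definition vertex_matrix (v v' : word_vertex) : R :=
  (v.1 == v'.1)%:R * vertex_block v.1 v.2 v'.2.

Lemma big_block (T : finType) (i : 'I_k) (a : T -> R) (F : 'I_k * T -> R) :
  \sum_(z : 'I_k * T) (i == z.1)%:R * a z.2 * F z = \sum_t a t * F (i, t).
Proof.
rewrite (eq_bigr (fun z => (i == z.1)%:R * a z.2 * F (z.1, z.2))) => [|[]//].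
rewrite -(pair_bigA _ (fun j t => (i == j)%:R * a t * F (j, t))) /=.
rewrite (bigD1 i) //= [X in _ + X]big1 ?addr0 => [|j /negPf ji].
  by apply: eq_bigr => t _; rewrite eqxx mul1r.
by apply: big1 => t _; rewrite eq_sym ji !mul0r.
Qed.

(** At a far end of a g-edge this is the equivariance of M, after reindexing
    by the involution g; at the hub end of the spokes it says that the rows
    of M sum to 1. *)
Lemma edge_matrix_respects_incidence :
  (forall i y, \sum_x M i y x = 1) ->
  (forall i g y x, M i (act (w' i) g y) (act (w i) g x) = M i y x) ->
  @respects_incidence R (word_graph w) (word_graph w') edge_matrix vertex_matrix.
Proof.
move=> M1 Mact F [i c] b; rewrite (big_block i (edge_block i c)) /=.
rewrite (@big_block _ _ (vertex_block _ _)).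
rewrite !big_option; case: c => [[y o]|] /=; last first.
  rewrite !mul1r; congr (_ + _).
  by rewrite !big1 // => [x|[x o]] _; rewrite mul0r.
rewrite mul0r add0r.
rewrite (eq_bigr (fun z => (o == z.2)%:R * M i y z.1
  * F (word_endpoint w (i, Some (z.1, z.2)) b))) => [|[]//].
rewrite -(pair_bigA _ (fun x o' => (o == o')%:R * M i y x
  * F (word_endpoint w (i, Some (x, o')) b))) /=.
transitivity (\sum_x M i y x * F (word_endpoint w (i, Some (x, o)) b)).
  apply: eq_bigr => x _; rewrite (bigD1 o) //= eqxx mul1r big1 ?addr0 // => o'.
  by rewrite eq_sym => /negPf ->; rewrite !mul0r.
case: b => /=; last by rewrite mul0r add0r.
case: o => [g|] /=.
  rewrite mul0r add0r [RHS](reindex_inj (inv_inj (actK (w i) g))) /=.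
  by apply: eq_bigr => x _; rewrite Mact.
rewrite -(mulr_suml _ _ _ (F (i, None))) M1 [X in _ + X]big1 ?addr0 // => x _.
by rewrite mul0r.
Qed.

End Transplant.

Lemma edge_matrixT (M : 'I_k -> site -> site -> R) e e' :
  edge_matrix (fun i x y => M i y x) e' e = edge_matrix M e e'.
Proof.
rewrite /edge_matrix eq_sym.
case: eqP => [->|_]; last by rewrite !mul0r.
case: e e' => [i [[y o]|]] [j [[x o']|]] //=.
by rewrite (eq_sym o).
Qed.

Lemma vertex_matrixT (M : 'I_k -> site -> site -> R) v v' :
  vertex_matrix (fun i x y => M i y x) v' v = vertex_matrix M v v'.
Proof.
rewrite /vertex_matrix eq_sym.
case: eqP => [->|_]; last by rewrite !mul0r.
by case: v v' => [i [y|]] [j [x|]].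
Qed.

Lemma edge_matrixK (M M' : 'I_k -> site -> site -> R) :
  (forall i x x', \sum_y M' i x y * M i y x' = (x == x')%:R) ->
  forall e e', \sum_j edge_matrix M' e j * edge_matrix M j e' = (e == e')%:R.
Proof.
move=> M'M [i c] [i' c']; rewrite (big_block i (edge_block M' i c)) big_option.
rewrite xpair_eqE /edge_matrix /=; case: (i == i'); last first.
  rewrite !mul0r mulr0 add0r big1 // => -[y o] _.
  by rewrite mul0r mulr0.
rewrite mulr1n mul1r; under eq_bigr do rewrite mul1r.
case: c c' => [[x o]|] [[x' o']|] /=.
- rewrite mul0r add0r.
  rewrite (eq_bigr (fun z => (o == z.2)%:R * M' i x z.1
    * ((z.2 == o')%:R * M i z.1 x'))) => [|[]//].
  rewrite -(pair_bigA _ (fun y o'' => (o == o'')%:R * M' i x y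
    * ((o'' == o')%:R * M i y x'))) /=.
  transitivity (\sum_y (o == o')%:R * (M' i x y * M i y x')).
    apply: eq_bigr => y _; rewrite (bigD1 o) //= eqxx mul1r big1 ?addr0.
      by rewrite mulrCA.
    by move=> o''; rewrite eq_sym => /negPf ->; rewrite !mul0r.
  rewrite -mulr_sumr M'M (inj_eq (@Some_inj _)) xpair_eqE andbC.
  by rewrite -mulnb natrM.
- by rewrite mul0r add0r big1 // => -[y o''] _; rewrite mulr0.
- by rewrite mulr0 add0r big1 // => -[y o''] _; rewrite mul0r.
- by rewrite mulr1 big1 ?addr0 // => -[y o''] _; rewrite mul0r.
Qed.

(** The conditions on the transposes follow from the same lemma, because the
    transpose of an intertwiner is an intertwiner in the other direction, with
    the column sums as its row sums. *)
Lemma word_quantum_graph_isospectral (k_gt0 : (0 < k)%N) (w w' : 'I_k -> bool) :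
  isospectral (word_quantum_graph k_gt0 w) (word_quantum_graph k_gt0 w').
Proof.
pose M (u u' : 'I_k -> bool) i := intertwiner R (u' i) (u i).
have resp u u' : @respects_incidence R (word_graph u) (word_graph u')
    (edge_matrix (M u u')) (vertex_matrix (M u u')).
  apply: edge_matrix_respects_incidence => *; first exact: intertwiner_row.
  exact: intertwiner_equivariant.
have respT u u' : @respects_incidence R (word_graph u') (word_graph u)
    (fun e e' => edge_matrix (M u u') e' e)
    (fun v v' => vertex_matrix (M u u') v' v).
  move=> F e b; under eq_bigr do rewrite -edge_matrixT.
  under [RHS]eq_bigr do rewrite -vertex_matrixT.
  apply: edge_matrix_respects_incidence => *; first exact: intertwiner_col.
  exact: intertwiner_equivariant.
have KK u u' e e' : \sum_j edge_matrix (M u' u) e j * edge_matrix (M u u') j e'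
    = (e == e')%:R.
  by apply: edge_matrixK => *; exact: intertwinerK.
exact: (@transplant_isospectral R (word_quantum_graph k_gt0 w)
  (word_quantum_graph k_gt0 w') _ _ _ _ (fun _ _ => erefl)
  (resp w w') (respT w w') (resp w' w) (respT w' w) (KK w w') (KK w' w)).
Qed.

End WordGraph.

(** * Reading the word off the graph *)

Lemma iso_adjacent (R : realType) (G H : quantum_graph R)
    (phi : vertex G -> vertex H) (psi : edge G -> edge H) :
  injective phi -> bijective psi ->
  (forall e, exists s : bool,
     forall b, endpoint (psi e) b = phi (endpoint e (s (+) b))) ->
  forall u v, adjacent (phi u) (phi v) = adjacent u v.
Proof.
move=> phi_inj [psi' _ psiK] psi_end u v; apply/existsP/existsP.
  move=> [[e b]] /=; rewrite -(psiK e); have [s se] := psi_end (psi' e).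
  rewrite !se !(inj_eq phi_inj) addbN => ends.
  by exists (psi' e, s (+) b).
move=> [[e b]] /= ends; have [s se] := psi_end e.
by exists (psi e, s (+) b); rewrite /= !se !(inj_eq phi_inj) addbN addKb.
Qed.

Lemma card_neighbours_iso (R : realType) (G H : quantum_graph R)
    (phi : vertex G -> vertex H) :
  bijective phi -> (forall u v, adjacent (phi u) (phi v) = adjacent u v) ->
  forall u, #|[set v | adjacent (phi u) v]%SET| = #|[set v | adjacent u v]%SET|.
Proof.
move=> [phi' phiK phi'K] adj_phi u.
rewrite -[RHS](card_imset _ (can_inj phiK)); apply: eq_card => v.
rewrite inE; apply/idP/imsetP => [uv|[x]]; last first.
  by rewrite inE => ux ->; rewrite adj_phi.
by exists (phi' v); rewrite ?inE ?phi'K // -adj_phi phi'K.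
Qed.

Section Reading.
Variable k : nat.
Implicit Types w : 'I_k -> bool.

(** A site has at most three neighbours, its hub and its images under a and
    b, whereas a hub is joined to its six sites. *)
Lemma hub_neighbours w (v : word_vertex k) :
  (3 < #|[set u | adjacent (G := word_graph w) v u]%SET|)%N = (v.2 == None).
Proof.
case: v => i [x|] /=.
  apply/negbTE; rewrite -leqNgt.
  pose N : seq (word_vertex k) :=
    [:: (i, None); (i, Some (act (w i) true x)); (i, Some (act (w i) false x))].
  apply: leq_trans (card_size N); apply: subset_leq_card.
  apply/fintype.subsetP => -[j [y|]].
    rewrite inE adj_sites => /andP[/eqP <- /existsP[g /eqP <-]].
    by rewrite !inE /= !xpair_eqE !eqxx; case: g; rewrite eqxx ?orbT.
  by rewrite inE adjacent_sym adj_hub_site => /eqP ->; rewrite !inE eqxx.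
rewrite eqxx; apply: (@leq_trans #|{: site}|).
  by rewrite card_prod card_option card_bool.
have f_inj : injective (fun x : site => (i, Some x) : word_vertex k).
  by move=> x y [].
rewrite -(card_codom f_inj); apply: subset_leq_card.
by apply/fintype.subsetP => _ /codomP[x ->]; rewrite inE adj_hub_site.
Qed.

(** The vertex v is a common fixed point of a and b. For the letter true
    every site is moved by a or b, and a neighbouring hub is joined to its
    own sites. *)
Lemma letter_false w (i : 'I_k) :
  w i = false <-> exists v : word_vertex k,
    [/\ v <> (i, None), adjacent (G := word_graph w) (i, None) v &
        forall u, adjacent (G := word_graph w) v u -> u = (i, None) \/ u = v].
Proof.
split=> [wi|[[j [[c t]|]] [vi iv only]]].
- exists (i, Some (None, true)); split=> //; first by rewrite adj_hub_site.
  move=> [j [y|]].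
    rewrite adj_sites wi => /andP[/eqP <- /existsP[g /eqP <-]].
    by right; case: g.
  by rewrite adjacent_sym adj_hub_site => /eqP ->; left.
- move: iv; rewrite adj_hub_site => /eqP ij; subst j.
  case wi: (w i) => //; have fl : act (w i) (if c is Some h then h else true)
      (c, t) = (c, ~~ t).
    by rewrite wi; case: c t {only vi} => [[]|] [].
  have /only : adjacent (G := word_graph w)
      (i, Some (c, t)) (i, Some (c, ~~ t)).
    by rewrite adj_sites eqxx; apply/existsP; eexists; apply/eqP/fl.
  by case=> [//|[]]; case: t {only vi fl}.
- have /only : adjacent (G := word_graph w) (j, None) (j, Some (None, true)).
    by rewrite adj_hub_site.
  by case.
Qed.

Variable R : realType.

(** An isomorphism maps hubs to hubs and fixes the first one, the only hub
    with a loop. It then fixes all of them by induction: hub n + 1 goes to a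
    neighbour of hub n, and not to a hub that is already known to be an
    image. Therefore it preserves the property of hubs in [letter_false]. *)
Lemma word_graph_iso_inj (k_gt0 : (0 < k)%N) w w' :
  qg_iso (word_quantum_graph R k_gt0 w) (word_quantum_graph R k_gt0 w') ->
  w =1 w'.
Proof.
move=> [phi [psi [phi_bij psi_bij psi_end _]]].
have phi_inj := bij_inj phi_bij.
have adj_phiG := iso_adjacent phi_inj psi_bij psi_end.
have nphi := card_neighbours_iso phi_bij adj_phiG.
have adj_phi (u v : word_vertex k) :
    adjacent (G := word_graph w') (phi u) (phi v)
  = adjacent (G := word_graph w) u v := adj_phiG u v.
have phi_hub (i : 'I_k) : exists j : 'I_k, phi (i, None) = (j, None).
  have : (phi (i, None)).2 == None.
    by rewrite -(hub_neighbours w') nphi hub_neighbours.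
  by case: (phi _) => j c /= /eqP ->; exists j.
have fix_hub n (lt_nk : (n < k)%N) :
    phi (Ordinal lt_nk, None) = (Ordinal lt_nk, None).
  elim/ltn_ind: n => -[|n] IHn in lt_nk *.
    have [j phij] := phi_hub (Ordinal lt_nk).
    have := adj_phi (Ordinal lt_nk, None) (Ordinal lt_nk, None).
    rewrite !phij !adj_hubs !orbb (_ : previous (Ordinal lt_nk) == _); last first.
      exact/eqP/val_inj.
    move=> /eqP/(congr1 val) /= jj; congr (_, _); apply: val_inj => /=.
    by case: (val j) jj => // m /eqP; rewrite /= ltn_eqF.
  have lt_n := ltnW lt_nk.
  have [j phij] := phi_hub (Ordinal lt_nk).
  have := adj_phi (Ordinal lt_nk, None) (Ordinal lt_n, None).
  rewrite phij (IHn n) // !adj_hubs.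
  rewrite (_ : previous (Ordinal lt_nk) == Ordinal lt_n); last first.
    exact/eqP/val_inj.
  move=> nbr; have [jn|nj] := leqP j n.
    suff : phi (j, None) = phi (Ordinal lt_nk, None) by move=> /phi_inj [->].
    by rewrite phij; case: j {phij nbr} jn => m lt_mk jn; exact: IHn.
  congr (_, _); apply: val_inj; move: nbr nj.
  move=> /orP[] /eqP/(congr1 val) /=; first by case: (val j) => // m /= ->.
  by move=> <-; rewrite ltnNge leq_pred.
have {}fix_hub (i : 'I_k) : phi (i, None) = (i, None).
  by case: i => n lt_nk; exact: fix_hub.
have [phi' phiK phi'K] := phi_bij.
suff false_iff i : w i = false <-> w' i = false.
  by move=> i; case wi: (w i) (false_iff i) => [] [];
    case: (w' i) => // h h'; [move: (h' erefl) | move: (h erefl)].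
split=> /letter_false[v [vi iv only]]; apply/letter_false.
  exists (phi v); split.
  - by rewrite -(fix_hub i) => /phi_inj.
  - by rewrite -fix_hub adj_phi.
  - move=> u; rewrite -(phi'K u) adj_phi => /only.
    by move=> [->|->]; [left; rewrite fix_hub|right].
have phi'i : phi' (i, None) = (i, None) by rewrite -[in LHS]fix_hub phiK.
exists (phi' v); split.
- by move=> v'i; apply: vi; rewrite -(phi'K v) v'i fix_hub.
- by rewrite -adj_phi fix_hub phi'K.
- move=> u; rewrite -adj_phi phi'K => /only [] uv; [left|right].
    by rewrite -(phiK u) uv.
  by rewrite -(phiK u) uv.
Qed.

End Reading.

(** * The exponential family *)

Section Family.
Variables (R : realType) (k : nat).

Definition word_family (i : 'I_#|{ffun 'I_k.+1 -> bool}|) : quantum_graph R :=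
  word_quantum_graph R (ltn0Sn k) (enum_val i).

Lemma word_family_isospectral : isospectral_family word_family.
Proof.
split=> // [i j ij iso|i j]; last exact: word_quantum_graph_isospectral.
move/negP: ij; apply; apply/eqP/enum_val_inj/ffunP.
exact: word_graph_iso_inj iso.
Qed.

Lemma expR_card_words :
  expR (ln 2 / 19 * (k.+1 * 19)%:R) = #|{ffun 'I_k.+1 -> bool}|%:R :> R.
Proof.
rewrite card_ffun card_bool card_ord natrX natrM.
rewrite [X in expR X](_ : _ = k.+1%:R * ln 2) ?expRM_natl ?lnK ?posrE //.
by field.
Qed.

End Family.

Theorem corollary5p12 (R : realType) :
  exists C c : R,
    [/\ 0 < C, 0 < c,
        forall N : nat, exists (n m : nat) (G : 'I_m -> quantum_graph R),
          [/\ (N <= n)%N,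
              C * expR (c * n%:R) <= m%:R,
              isospectral_family G &
              forall i, #|edge (G i)| = n] &
        forall T0 : R, exists (T : R) (m : nat) (G : 'I_m -> quantum_graph R),
          [/\ T0 <= T,
              C * expR (c * T) <= m%:R,
              isospectral_family G,
              forall i (e : edge (G i)), edge_length e = 1 &
              forall i, total_length (G i) = T]].
Proof.
exists 1, (ln 2 / 19); split=> //.
- by rewrite divr_gt0 // ln_gt0 // ltr1n.
- move=> N; exists (N.+1 * 19)%N, _, (@word_family R N).
  rewrite mul1r expR_card_words; split=> //.
  + by rewrite (leq_trans (leqnSn N)) // leq_pmulr.
  + exact: word_family_isospectral.
  + by move=> i; exact: card_word_edge.
- move=> T0; pose k := Num.truncn (Num.max 0 T0).
  exists (k.+1 * 19)%:R, _, (@word_family R k).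
  rewrite mul1r expR_card_words; split=> //.
  + apply: (@le_trans _ _ k.+1%:R); last by rewrite ler_nat leq_pmulr.
    apply: (@le_trans _ _ (Num.max 0 T0)); first by rewrite le_max lexx orbT.
    by apply/ltW/truncnS_gt.
  + exact: word_family_isospectral.
  + by move=> i; rewrite /total_length sumr_const card_word_edge.
Qed.
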